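(* Let $d$ and $k$ be positive integers, and let $\mathcal{D}_d$ be any nonempty class of forms of degree $d$ closed under linear changes of coordinates. Then \begin{itemize} \item for $z\leq \frac{\dim(S_{d+k})}{\dim(S_k)}-\dim(S_k)$, $HF_{(\mathcal{D}_d,z)}(d+k)=z\cdot \dim(S_k)$; \item for $z\geq \frac{\dim(S_{d+k})}{\dim(S_k)}+\dim(S_k)$, $HF_{(\mathcal{D}_d,z)}(d+k)= \dim(S_{d+k})$. \end{itemize}
   Context: $\mathbb{K}$ is an algebraically closed field of characteristic zero, and $S=\mathbb{K}[x_1,\ldots,x_n]$ is the polynomial ring in $n$ variables; $n$ and $\mathbb{K}$ are fixed. $S_m$ denotes the $m$-th graded component of $S$, i.e. the linear space of all homogeneous polynomials (forms) of degree $m$ in $n$ variables. Examples of classes $\mathcal{D}_d$ are $\mathcal{D}_d=S_d$ and the set of all $d$-th powers of linear forms. $HF_{(\mathcal{D}_d,z)}(m)$ denotes the dimension of the $m$-th graded component of an ideal of $S$ generated by $z$ generic forms from $\mathcal{D}_d$.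
   Formalization: ''Nonempty class of forms'' is read as a class containing a nonzero form: the class consisting of the zero form alone is closed under linear changes of coordinates but makes the stated Hilbert function values false. *)

(* Defs.v *)
From HB Require Import structures.
From mathcomp Require Import all_boot all_order all_algebra.
From mathcomp Require Import mpoly.

Set Implicit Arguments.
Unset Strict Implicit.
Unset Printing Implicit Defensive.

Import GRing.Theory.
Local Open Scope ring_scope.

Section Zariski.
Variables (K : fieldType) (V : vectType K).
Implicit Types (U W X : V -> Prop) (P : {mpoly K[\dim {: V}]}).

(* Coordinates are taken in the basis [vbasis fullv]; the resulting topology
   does not depend on that choice. *)
Definition polyfun P (v : V) : K := P.@[fun i => coord (vbasis {: V}) i v].

Definition zariski_open U : Prop :=
  exists E : {mpoly K[\dim {: V}]} -> Prop,
    forall v, U v <-> exists2 P, E P & polyfun P v != 0.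

(* U meets X in a dense subset of X, for the topology induced on X. *)
Definition dense_in X U : Prop :=
  forall W, zariski_open W -> (exists2 v, X v & W v) ->
    exists2 v, X v & U v /\ W v.

(* X need not be closed, nor irreducible. *)
Definition generically X (Q : V -> Prop) : Prop :=
  exists U, [/\ zariski_open U, dense_in X U & forall v, X v -> U v -> Q v].

End Zariski.

Section Forms.
(* The polynomial ring has n.+1 variables: [dhomog], the space of forms of a
   given degree (zero included), is a vectType only in that case. *)
Variables (n : nat) (K : fieldType).

Definition dimS (m : nat) : nat := \dim {: dhomog n.+1 K m}.

Definition lin_change (A : 'M[K]_n.+1) (f : {mpoly K[n.+1]}) :
    {mpoly K[n.+1]} :=
  f \mPo [tuple \sum_(j < n.+1) A i j *: 'X_j | i < n.+1].

Definition closed_lin_change d (D : dhomog n.+1 K d -> Prop) : Prop :=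
  forall (A : 'M[K]_n.+1) (f g : dhomog n.+1 K d),
    A \in unitmx -> D f ->
    (g : {mpoly K[n.+1]}) = lin_change A (f : {mpoly K[n.+1]}) -> D g.

Definition in_ideal d z (F : {ffun 'I_z -> dhomog n.+1 K d})
    (p : {mpoly K[n.+1]}) : Prop :=
  exists g : 'I_z -> {mpoly K[n.+1]},
    p = \sum_(i < z) g i * (F i : {mpoly K[n.+1]}).

(* h is the dimension of the degree m component of the homogeneous ideal I. *)
Definition graded_dim (I : {mpoly K[n.+1]} -> Prop) (m h : nat) : Prop :=
  exists2 V : {vspace dhomog n.+1 K m},
    (forall p : dhomog n.+1 K m, p \in V <-> I p) & \dim V = h.

(* [HF D z m h] reads "HF_(D, z)(m) = h"; [HF_inj] below shows that h is
   then uniquely determined. *)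
Definition HF d (D : dhomog n.+1 K d -> Prop) (z m h : nat) : Prop :=
  generically (fun F : {ffun 'I_z -> dhomog n.+1 K d} => forall i, D (F i))
              (fun F => graded_dim (in_ideal F) m h).

Lemma HF_inj d (D : dhomog n.+1 K d -> Prop) z m h1 h2 :
  (exists f, D f) -> HF D z m h1 -> HF D z m h2 -> h1 = h2.
Proof.
move=> [f Df] [U1 [_ dU1 Q1]] [U2 [oU2 dU2 Q2]].
have [F XF [U2F _]] : exists2 F : {ffun 'I_z -> dhomog n.+1 K d},
    (forall i, D (F i)) & U2 F /\ True.
  apply: (dU2 (fun=> True)); last by exists [ffun=> f] => // i; rewrite ffunE.
  exists (fun=> True) => v; split=> // _; exists 1 => //.
  by rewrite /polyfun mevalC oner_eq0.
have {F XF U2F} [F XF [U1F U2F]] := dU1 U2 oU2 (ex_intro2 _ _ F XF U2F).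
have [V1 V1P <-] := Q1 F XF U1F; have [V2 V2P <-] := Q2 F XF U2F.
suff -> : V1 = V2 by [].
by apply/vspaceP=> p; apply/idP/idP=> [/V1P/V2P|/V2P/V1P].
Qed.

End Forms.

(* Main.v *)
Require Import Defs.
From HB Require Import structures.
From mathcomp Require Import all_boot all_order all_algebra.
From mathcomp Require Import mpoly.
From mathcomp Require Import zify.
From Stdlib Require Import ClassicalEpsilon FunctionalExtensionality.

(* Let s = dim S_k, N = dim S_(d+k), and let W(f_1, .., f_z) be the sum of the
   subspaces S_k f_i of S_(d+k).  Only a lower bound on its generic dimension
   is needed.  After a change of coordinates, every nonzero form of degree d
   degenerates to the d-th power of any given linear form, so by
   semicontinuity of the rank it suffices to treat powers of linear forms.

   Let a_z be the maximal dimension of W(l_1^d, .., l_z^d) and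
   r_z = a_(z+1) - a_z, so that s - r_z is the dimension of
   P(l; l_1, .., l_z) = {p | p l^d in W(l_1^d, .., l_z^d)} for generic points.
   This space shrinks when points l_i are removed, so r_z is nonincreasing.
   If r_(z+1) = r_z, adding a point does not change P, hence neither does
   replacing the points l_i one at a time: P does not depend on them.  If
   moreover r_z < s, some nonzero p l^d lies in W(l_1^d, .., l_z^d) for all
   generic l_1, .., l_z; the intersection of these spaces is invariant under
   coordinate changes, hence equal to S_(d+k) (characteristic zero), and
   a_z = N.  Thus r_z stays equal to s for a while, then decreases strictly to
   0 in at most s steps, and reaching 0 means a_z = N. *)

Set Implicit Arguments.
Unset Strict Implicit.
Unset Printing Implicit Defensive.

Import GRing.Theory.
Import Num.Theory VectorInternalTheory.
Local Open Scope ring_scope.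

(** * Generic rank *)

Section MatrixRank.
Variable K : fieldType.

(** With [B] and [C] fixed, the determinant of [B *m A' *m C] is a polynomial in [A'] that is
    nonzero at [A]; together with [mxrank_ge] this yields every semicontinuity statement below. *)
Lemma mxrank_witness m n (A : 'M[K]_(m, n)) :
  exists B : 'M_(\rank A, m), exists C, B *m A *m C = 1%:M.
Proof.
exists (pid_mx (\rank A) *m invmx (col_ebase A)).
exists (invmx (row_ebase A) *m pid_mx (\rank A)).
rewrite -[X in _ *m X *m _]mulmx_ebase !mulmxA mulmxKV ?col_ebase_unit //.
rewrite mulmxK ?row_ebase_unit // !mul_pid_mx.
set e := minn n _.
suff -> : e = \rank A by rewrite pid_mx_1.
by rewrite /e; have := rank_leq_row A; have := rank_leq_col A; lia.
Qed.

Lemma mxrank_ge m n r (A : 'M[K]_(m, n)) (B : 'M_(r, m)) C :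
  \det (B *m A *m C) != 0 -> (r <= \rank A)%N.
Proof.
rewrite -unitfE -[_ \is a _]/(_ \in unitmx) -row_free_unit => /eqP {1}<-.
by apply: leq_trans (mxrankM_maxl _ _) (mxrankM_maxr _ _).
Qed.

Lemma mxrank_adds_coker m1 m2 N (A : 'M[K]_(m1, N)) (B : 'M_(m2, N)) :
  \rank (A + B)%MS = (\rank B + \rank (A *m cokermx B))%N.
Proof.
have := mxrank_mul_ker A (cokermx B); have := mxrank_sum_cap A B.
have -> : \rank (A :&: kermx (cokermx B))%MS = \rank (A :&: B)%MS.
  apply/eqmx_rank/andP; split; apply: capmxS => //.
    by rewrite submxE mulmx_ker.
  by apply/sub_kermxP; apply: mulmx_coker.
by lia.
Qed.

End MatrixRank.

(** * Conditions holding for all but finitely many parameters *)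

Section Cofinite.
Variable K : closedFieldType.
Implicit Types (Q : K -> Prop) (p : {poly K}).

Definition cofinite Q : Prop :=
  exists2 p, p != 0 & forall t, p.[t] != 0 -> Q t.

Lemma cofinite_poly p t0 : p.[t0] != 0 -> cofinite (fun t => p.[t] != 0).
Proof. by move=> p0; exists p => //; apply: contraNneq p0 => ->; rewrite horner0. Qed.

Lemma cofiniteT Q : (forall t, Q t) -> cofinite Q.
Proof. by move=> QT; exists 1 => //; apply: oner_neq0. Qed.

Lemma cofiniteS Q Q' : (forall t, Q t -> Q' t) -> cofinite Q -> cofinite Q'.
Proof. by move=> sQ [p p0 pQ]; exists p => // t /pQ/sQ. Qed.

Lemma cofiniteI Q Q' : cofinite Q -> cofinite Q' -> cofinite (fun t => Q t /\ Q' t).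
Proof.
move=> [p p0 pQ] [p' p'0 pQ']; exists (p * p'); first by rewrite mulf_neq0.
by move=> t; rewrite hornerM mulf_eq0 => /norP[/pQ ? /pQ' ?].
Qed.

Lemma cofinite_ex Q : cofinite Q -> exists t, Q t.
Proof. by move=> [p /closed_nonrootP[t pt] pQ]; exists t; apply: pQ. Qed.

Lemma poly_eq0_fun p : (forall t, p.[t] = 0) -> p = 0.
Proof.
move=> p0; apply/eqP/negPn/negP => /closed_nonrootP[t].
by rewrite /root p0 eqxx.
Qed.

Lemma horner_eq0_cofinite p : cofinite (fun t => p.[t] = 0) -> p = 0.
Proof.
move=> cp; apply: poly_eq0_fun => t; apply/eqP/negPn/negP => /cofinite_poly.
by move=> /(cofiniteI cp)/cofinite_ex[u [->]]; rewrite eqxx.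
Qed.

(** Lower semicontinuity: the compression that witnesses the rank at [t0] has a determinant
    polynomial in [t], nonzero at [t0]. *)
Lemma mxrank_curve m n (M : 'M[{poly K}]_(m, n)) t0 :
  cofinite (fun t => \rank (map_mx (horner^~ t0) M) <= \rank (map_mx (horner^~ t) M))%N.
Proof.
have [B [C BC]] := mxrank_witness (map_mx (horner^~ t0) M).
pose p := \det (map_mx polyC B *m M *m map_mx polyC C).
have pE t : p.[t] = \det (B *m map_mx (horner^~ t) M *m C).
  rewrite -horner_evalE -det_map_mx !map_mxM -!map_mx_comp /=.
  congr (\det (_ *m _ *m _)); apply/matrixP=> i j; rewrite !mxE /=;
  by rewrite ?horner_evalE ?hornerC.
have: p.[t0] != 0 by rewrite pE BC det1 oner_neq0.
by move/cofinite_poly; apply: cofiniteS => t; rewrite pE => /mxrank_ge.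
Qed.

End Cofinite.

(** * Sums of row spaces indexed by a sequence *)

Section Stack.
Variables (K : fieldType) (s N : nat).

Fixpoint stack_rows I (J : seq I) : nat := if J is _ :: J' then s + stack_rows J' else 0.

Fixpoint stack I (M : I -> 'M[K]_(s, N)) (J : seq I) : 'M[K]_(stack_rows J, N) :=
  if J is i :: J' then col_mx (M i) (stack M J') else 0.

Lemma stack_rowsE I (J : seq I) : stack_rows J = (size J * s)%N.
Proof. by elim: J => //= i J ->; rewrite mulSn. Qed.

Lemma stack_cons I M (i : I) J : (stack M (i :: J) :=: M i + stack M J)%MS.
Proof. by apply: eqmx_sym; apply: addsmxE. Qed.

Lemma stack_subP (I : eqType) (M : I -> 'M[K]_(s, N)) J m (A : 'M_(m, N)) :
  reflect {in J, forall i, (M i <= A)%MS} (stack M J <= A)%MS.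
Proof.
apply: (iffP idP).
  elim: J => //= j J IH; rewrite col_mx_sub => /andP[Mj /IH sJ] i.
  by rewrite inE => /predU1P[-> //|/sJ].
elim: J => [|j J IH] sJ /=; first by rewrite sub0mx.
rewrite col_mx_sub sJ ?mem_head //=; apply: IH => i iJ.
by rewrite sJ // inE iJ orbT.
Qed.

Lemma sub_stack (I : eqType) (M : I -> 'M[K]_(s, N)) J i :
  i \in J -> (M i <= stack M J)%MS.
Proof. by move: i; apply/stack_subP. Qed.

Lemma stackS (I : eqType) (M : I -> 'M[K]_(s, N)) J J' :
  {subset J <= J'} -> (stack M J <= stack M J')%MS.
Proof. by move=> sJ; apply/stack_subP => i /sJ/sub_stack. Qed.

Lemma stack_map I I' (f : I -> I') M J : (stack M (map f J) :=: stack (M \o f) J)%MS.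
Proof.
elim: J => //= i J IH; apply: (eqmx_trans (stack_cons _ _ _)).
by apply: eqmx_trans (eqmx_sym (stack_cons _ _ _)); apply: adds_eqmx.
Qed.

Lemma eq_stack (I : eqType) (M M' : I -> 'M[K]_(s, N)) J :
  {in J, M =1 M'} -> stack M J = stack M' J.
Proof.
elim: J => //= i J IH eM; rewrite eM ?mem_head // IH // => j jJ.
by rewrite eM // inE jJ orbT.
Qed.

Lemma sub_stackP (I : eqType) (M : I -> 'M[K]_(s, N)) J (v : 'rV_N) : uniq J ->
  reflect (exists c, v = \sum_(i <- J) c i *m M i) (v <= stack M J)%MS.
Proof.
move=> uJ; apply: (iffP idP); last first.
  move=> [c ->]; rewrite big_seq_cond; apply: summx_sub => i /andP[iJ _].
  by apply: submx_trans (submxMl _ _) (sub_stack _ iJ).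
elim: J v uJ => [|j J IH] v /=.
  by move=> _ /submx0null->; exists (fun=> 0); rewrite big_nil.
case/andP=> jJ uJ; rewrite stack_cons => /sub_addsmxP[[a b] /= ->].
have [c ->] := IH (b *m stack M J) uJ (submxMl _ _).
exists (fun i => if i == j then a else c i); rewrite big_cons eqxx.
congr (_ + _); apply: eq_big_seq => i iJ; case: eqP => // ij.
by rewrite -ij iJ in jJ.
Qed.

Lemma stackD I (M M' : I -> 'M[K]_(s, N)) J :
  stack (fun i => M i + M' i) J = stack M J + stack M' J.
Proof. by elim: J => [|i J IH] /=; rewrite ?addr0 // IH add_col_mx. Qed.

Lemma stackZ I (M : I -> 'M[K]_(s, N)) a J :
  stack (fun i => a *: M i) J = a *: stack M J.
Proof. by elim: J => [|i J IH] /=; rewrite ?scaler0 // IH scale_col_mx. Qed.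

End Stack.

(** * Generic dimension of a sum of subspaces depending on points *)

Section GenericRank.
Variables (K : closedFieldType) (s N : nat) (E : lmodType K).
(** Later [E] is the space of linear forms, and [psi u] is the matrix of multiplication by the
    [d]-th power of [u] from S_k to S_(d+k). *)
Variable psi : E -> 'M[K]_(s, N).
Hypothesis psi_line : forall u v, exists M : 'M[{poly K}]_(s, N),
  forall t, map_mx (horner^~ t) M = psi ((1 - t) *: u + t *: v).
Implicit Types (L : nat -> E) (J : seq nat).

Local Notation W L J := (stack (psi \o L) J).

(** The number a_z of the overview. Ranks are at most [N], so the maximum is finite; excluded middle
    turns the existence of [L] into a boolean. *)
Definition grank z : nat :=
  \max_(r < N.+1 | is_left (excluded_middle_informative
                     (exists L, r <= \rank (W L (iota 0 z)))%N)) r.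

Lemma mxrank_stack_map L (f : nat -> nat) J :
  \rank (W L (map f J)) = \rank (W (L \o f) J).
Proof. exact/eqmx_rank/eqmxP/stack_map. Qed.

Lemma mxrank_stack_nth L J :
  \rank (W L J) = \rank (W (L \o nth 0%N J) (iota 0 (size J))).
Proof. by rewrite -mxrank_stack_map -/(mkseq _ _) mkseq_nth. Qed.

Lemma leq_grank L J : (\rank (W L J) <= grank (size J))%N.
Proof.
rewrite mxrank_stack_nth.
set r := \rank _; have rN : (r < N.+1)%N by rewrite ltnS rank_leq_col.
rewrite /grank; apply: (bigmax_sup (Ordinal rN)) => //=.
by case: excluded_middle_informative => // -[]; exists (L \o nth 0%N J).
Qed.

Lemma grank_attained J : uniq J -> exists L, \rank (W L J) = grank (size J).
Proof.
move=> uJ; set z := size J.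
have [L0 L0P] : exists L, (grank z <= \rank (W L (iota 0 z)))%N.
  rewrite /grank; elim/big_ind: _ => [|x y [L xL] [L' yL']|r].
  - by exists (fun=> 0).
  - by case: (leqP x y); [exists L' | exists L]; lia.
  by case: excluded_middle_informative.
(* Since [J] has no repetition, [index] renumbers its labels as 0, .., z - 1. *)
exists (L0 \o index^~ J); apply/eqP; rewrite eqn_leq leq_grank.
rewrite mxrank_stack_nth.
rewrite (@eq_stack _ _ _ _ _ (psi \o L0)) // => i.
by rewrite mem_iota => /andP[_ iz]; rewrite /= index_uniq.
Qed.

Lemma grank_leqN z : (grank z <= N)%N.
Proof. by apply/bigmax_leqP => r _; rewrite -ltnS. Qed.

Lemma grank0 : grank 0 = 0%N.
Proof. by have [L <-] := @grank_attained [::] isT; rewrite mxrank0. Qed.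

Definition line L L' (t : K) : nat -> E := fun i => (1 - t) *: L i + t *: L' i.

Lemma line0 L L' : line L L' 0 = L.
Proof.
apply: functional_extensionality => i.
by rewrite /line subr0 scale1r scale0r addr0.
Qed.

Lemma line1 L L' : line L L' 1 = L'.
Proof.
apply: functional_extensionality => i.
by rewrite /line subrr scale1r scale0r add0r.
Qed.

Lemma stack_line L L' J : exists M : 'M[{poly K}]_(stack_rows s J, N),
  forall t, map_mx (horner^~ t) M = W (line L L' t) J.
Proof.
elim: J => [|j J [M MP]] /=.
  by exists 0 => t; apply/matrixP => -[].
have [M' M'P] := psi_line (L j) (L' j).
by exists (col_mx M' M) => t; rewrite map_col_mx MP M'P.
Qed.

Definition generic L J := (grank (size J) <= \rank (W L J))%N.

Lemma generic_rank L J : generic L J -> \rank (W L J) = grank (size J).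
Proof. by move=> gL; apply/eqP; rewrite eqn_leq leq_grank. Qed.

Lemma generic_line L L' t0 J : generic (line L L' t0) J ->
  cofinite (fun t => generic (line L L' t) J).
Proof.
have [M MP] := stack_line L L' J; rewrite /generic -MP => gt0.
by have := mxrank_curve M t0; apply: cofiniteS => t; rewrite -MP; apply: leq_trans.
Qed.

Lemma generic_line_all L L' t0 (JJ : seq (seq nat)) : all (generic (line L L' t0)) JJ ->
  cofinite (fun t => all (generic (line L L' t)) JJ).
Proof.
elim: JJ => [|J JJ IH] /=; first by move=> _; apply: cofiniteT.
move=> /andP[/generic_line gJ /IH gJJ]; have := cofiniteI gJ gJJ.
by apply: cofiniteS => t /andP.
Qed.

(** Join a configuration generic for [J] to one generic for the rest by a line: each condition holds
    at one end, hence for almost all [t], so both hold at some [t]. *)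
Lemma generic_ex (JJ : seq (seq nat)) : all uniq JJ -> exists L, all (generic L) JJ.
Proof.
elim: JJ => [|J JJ IH] /=; first by exists (fun=> 0).
case/andP => /grank_attained[L gL] /IH[L' gL'].
have := @generic_line L L' 0 J; rewrite line0 /generic gL => /(_ (leqnn _)) cJ.
have := @generic_line_all L L' 1 JJ; rewrite line1 => /(_ gL') cJJ.
by have [t /andP] := cofinite_ex (cofiniteI cJ cJJ); exists (line L L' t).
Qed.

(** The space P(l; l_1, .., l_z) of the overview, as a row space. *)
Definition relations L J f : 'M[K]_s := kermx (psi f *m cokermx (W L J)).

Lemma sub_relations L J f m (A : 'M_(m, s)) :
  (A <= relations L J f)%MS = (A *m psi f <= W L J)%MS.
Proof.
by rewrite [RHS]submxE -mulmxA; apply/sub_kermxP/eqP.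
Qed.

Lemma relationsS L J J' f : {subset J <= J'} ->
  (relations L J f <= relations L J' f)%MS.
Proof.
move=> sJ; rewrite sub_relations (submx_trans _ (stackS _ sJ)) //.
by rewrite -sub_relations.
Qed.

Lemma mxrank_relations L J j :
  (\rank (W L (j :: J)) + \rank (relations L J (L j)) = \rank (W L J) + s)%N.
Proof.
rewrite stack_cons mxrank_adds_coker mxrank_ker /=.
set X := psi _ *m _; set w := \rank (W L J). by have := rank_leq_row X; lia.
Qed.

Lemma grank_relations L J j : generic L J -> generic L (j :: J) ->
  (grank (size J).+1 + \rank (relations L J (L j)) = grank (size J) + s)%N.
Proof.
by move=> /generic_rank g /generic_rank; rewrite -g /= => <-; apply: mxrank_relations.
Qed.

(** Relations at a fresh point [m] can only grow when a point is added to [J], and their dimension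
    is [s] minus the increment. *)
Lemma grank_concave z : (grank z + grank z.+2 <= (grank z.+1).*2)%N.
Proof.
pose J := iota 0 z; pose J' := iota 0 z.+1; pose m := z.+1.
have [|L /and5P[gJ gJ' gmJ gmJ' _]] := @generic_ex [:: J; J'; m :: J; m :: J'].
  by rewrite /= !iota_uniq !mem_iota /=; lia.
have := grank_relations gJ gmJ; have := grank_relations gJ' gmJ'.
have : {subset J <= J'} by move=> i; rewrite !mem_iota; lia.
move/(relationsS L (L m))/mxrankS; rewrite !size_iota; lia.
Qed.

Lemma grank_mono z : (grank z <= grank z.+1)%N.
Proof.
have [|L /and3P[gJ gJ' _]] := @generic_ex [:: iota 0 z; iota 0 z.+1].
  by rewrite /= !mem_iota iota_uniq; case: (iota_uniq 1 z) => //=; lia.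
have := generic_rank gJ; have := generic_rank gJ'; rewrite !size_iota => <- <-.
by apply/mxrankS/stackS => i; rewrite !mem_iota; lia.
Qed.

Hypothesis psi_free : exists u, row_free (psi u).

(* Sliding the window [iota i z] one step at a time replaces the points
   [L 0, .., L z.-1] by the independent points [L z, .., L (z + z).-1] without
   changing the relations at [L (z + z).+1]. *)
Lemma grank_stall z : (grank z + grank z.+2 = (grank z.+1).*2)%N ->
  (grank z.+1 < grank z + s)%N ->
  exists2 q : 'rV[K]_N, q != 0 &
    forall L, \rank (W L (iota 0 z)) = grank z -> (q <= W L (iota 0 z))%MS.
Proof.
move=> stall ltr; pose m := (z + z).+1.
(* All these windows end before [m]. Length 0 is included so that [[:: m]] occurs in [JJ], which
   makes [psi (L m)] row free. *)
pose JJ0 := [seq iota i e | i <- iota 0 z.+1, e <- [:: 0; z; z.+1]].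
pose JJ := JJ0 ++ map (cons m) JJ0.
have iotaJJ0 i e : (i <= z)%N -> e \in [:: 0; z; z.+1] -> iota i e \in JJ0.
  by move=> iz ez; apply: allpairs_f => //; rewrite mem_iota.
have JJ0P J : J \in JJ0 -> uniq J && (m \notin J).
  case/allpairsPdep => i [e [+ ei ->]]; rewrite mem_iota iota_uniq => /= iz.
  by move: ei; rewrite mem_iota !inE /m; lia.
have uJJ : all uniq JJ.
  apply/allP => J; rewrite mem_cat => /orP[/JJ0P/andP[]//|].
  by case/mapP => J' /JJ0P/andP[uJ mJ] -> /=; rewrite mJ.
have genJJ L : all (generic L) JJ ->
    {in JJ0, forall J,
      (grank (size J).+1 + \rank (relations L J (L m)) = grank (size J) + s)%N}.
  move=> /allP gL J JJ0J; apply: grank_relations; apply: gL; rewrite mem_cat ?JJ0J //.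
  by rewrite map_f ?orbT.
(* Equal increments give both relation spaces the same dimension, so the inclusion is an
   equality. *)
have relE L J J' : all (generic L) JJ -> J \in JJ0 -> J' \in JJ0 ->
    size J = z -> size J' = z.+1 -> {subset J <= J'} ->
    (relations L J (L m) :=: relations L J' (L m))%MS.
  move=> gL JJ0J JJ0J' zJ zJ' sJ; apply/eqmxP.
  rewrite -(mxrank_leqif_eq (relationsS L (L m) sJ)) //.
  by have := genJJ _ gL _ JJ0J; have := genJJ _ gL _ JJ0J'; rewrite zJ zJ'; lia.
(* Consecutive windows of length [z] both lie in one window of length [z.+1]. *)
have slide L i : all (generic L) JJ -> (i <= z)%N ->
    (relations L (iota 0 z) (L m) :=: relations L (iota i z) (L m))%MS.
  move=> gL; elim: i => // i IH iz; apply: eqmx_trans (IH (ltnW iz)) _.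
  have iz' := ltnW iz.
  apply: eqmx_trans (relE _ _ (iota i z.+1) gL _ _ _ _ _)
                    (eqmx_sym (relE _ _ _ gL _ _ _ _ _));
    rewrite ?size_iota ?iotaJJ0 ?inE ?eqxx ?orbT // => j; rewrite !mem_iota; lia.
have [L gL] := generic_ex uJJ.
have freeL : row_free (psi (L m)).
  have [u fu] := psi_free.
  have : generic L [:: m].
    by apply: (allP gL); rewrite mem_cat (map_f (cons m) (iotaJJ0 0 0 _ _)) ?orbT.
  rewrite /generic => gm; have := leq_trans (leq_grank (fun=> u) [:: m]) gm.
  by rewrite !stack_cons /= !addsmx0 /row_free eqn_leq rank_leq_row /= (eqP fu).
have [p p0 pR] : exists2 p : 'rV_s, p != 0 & (p <= relations L (iota 0 z) (L m))%MS.
  have [R0|] := eqVneq (relations L (iota 0 z) (L m)) 0; last first.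
    by exists (nz_row (relations L (iota 0 z) (L m))); rewrite ?nz_row_eq0 // nz_row_sub.
  have := genJJ _ gL _ (iotaJJ0 0 z (leq0n _) _); rewrite R0 mxrank0 size_iota.
  by rewrite !inE eqxx orbT => /(_ isT); lia.
exists (p *m psi (L m)).
  by rewrite -(mul0mx _ (psi (L m))) (inj_eq (row_free_inj freeL)).
move=> L2 rL2.
(* Only the second window moves, from [L] to [L2]. The first window and the point [m] stay fixed, so
   [p] remains a relation there, and sliding carries it to the moving window. *)
pose L' i := if (z <= i < z + z)%N then L2 (i - z)%N else L i.
have fixL t i : ~~ (z <= i < z + z)%N -> line L L' t i = L i.
  by move=> /negPf iz; rewrite /line /L' iz -scalerDl subrK scale1r.
have WL' : (W L' (iota z z) :=: W L2 (iota 0 z))%MS.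
  rewrite -[z in iota z _]addn0 iotaDl; apply: eqmx_trans (stack_map _ _ _) _.
  rewrite (@eq_stack _ _ _ _ _ (psi \o L2)) // => i; rewrite mem_iota /= /L' => iz.
  by rewrite leq_addr ltn_add2l iz addKn.
have cofq : cofinite (fun t => p *m psi (L m) <= W (line L L' t) (iota z z))%MS.
  have := @generic_line_all L L' 0 JJ; rewrite line0 => /(_ gL).
  apply: cofiniteS => t gt; have fm : line L L' t m = L m by rewrite fixL // /m; lia.
  have := slide _ z gt (leqnn z); rewrite fm -sub_relations => <-.
  rewrite sub_relations (@eq_stack _ _ _ _ _ (psi \o L)) -?sub_relations // => i.
  by rewrite mem_iota /= => iz; rewrite fixL //; lia.
have [M MP] := stack_line L L' (iota z z).
(* For almost all [t] the extra row does not raise the rank above [grank z]. By semicontinuity the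
   same bound holds at [t = 1], where the window alone already has rank [grank z]; hence the row
   lies in its span. *)
pose M' := col_mx (map_mx polyC (p *m psi (L m))) M.
have M'P t :
    map_mx (horner^~ t) M' = col_mx (p *m psi (L m)) (W (line L L' t) (iota z z)).
  rewrite map_col_mx MP -map_mx_comp; congr col_mx.
  by apply/matrixP=> i j; rewrite !mxE /= hornerC.
have [t [tq]] := cofinite_ex (cofiniteI cofq (mxrank_curve M' 1)).
rewrite !M'P line1 -!addsmxE (addsmx_idPr tq) => le1.
rewrite -WL'; apply: submx_trans (addsmxSl _ (W L' (iota z z))) _.
rewrite -(mxrank_leqif_sup (addsmxSr _ _)) eqn_leq mxrankS ?addsmxSr //=.
rewrite (leq_trans le1) // WL' rL2.
by have := leq_grank (line L L' t) (iota z z); rewrite size_iota.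

Qed.


Lemma leq_grank_succ z : (grank z.+1 <= grank z + s)%N.
Proof.
have [|L /and3P[g gz _]] := @generic_ex [:: iota 0 z; z :: iota 0 z].
  by rewrite /= iota_uniq mem_iota; lia.
by have := grank_relations g gz; rewrite size_iota; lia.
Qed.

Lemma leq_grank_add y i : (grank y <= grank (y + i))%N.
Proof. by elim: i => [|i IH]; rewrite ?addn0 // addnS (leq_trans IH) ?grank_mono. Qed.

Lemma leq_grank_mul z : (grank z <= z * s)%N.
Proof.
elim: z => [|z IH]; first by rewrite grank0.
by rewrite mulSn addnC (leq_trans (leq_grank_succ z)) // leq_add2r.
Qed.

(** Abstract form of the invariance argument under coordinate changes; [powM_irr] establishes it for
    powers of linear forms. *)
Hypothesis psi_irr : forall z (q : 'rV[K]_N), q != 0 ->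
  (forall L, \rank (W L (iota 0 z)) = grank z -> (q <= W L (iota 0 z))%MS) ->
  grank z = N.

Lemma grank_stall_full z : (grank z + grank z.+2 = (grank z.+1).*2)%N ->
  (grank z.+1 < grank z + s)%N -> grank z = N.
Proof. by move=> st lt; have [q /psi_irr] := grank_stall st lt; apply. Qed.

(* As long as the increments are positive and smaller than [s], they decrease
   strictly; so they vanish after at most [s] steps. *)
Lemma grank_full y : (grank y.+1 < grank y + s)%N -> grank (y + s) = N.
Proof.
move=> lty; have s0 : (0 < s)%N by have := grank_mono y; lia.
(* In the notation of the overview, r_(y+i) + i < s or r_(y+i) = 0. Equality of two consecutive
   increments below [s] forces rank [N], after which they vanish. *)
have decr i : (grank (y + i).+1 + i < grank (y + i) + s)%N \/
              grank (y + i).+1 = grank (y + i).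
  elim: i => [|i]; first by rewrite !addn0; left.
  rewrite (addnS y); set z := (y + i)%N => IH.
  have cz := grank_concave z; have mz := grank_mono z; have mz1 := grank_mono z.+1.
  have [st|nst] := eqVneq (grank z + grank z.+2)%N (grank z.+1).*2; last by lia.
  have := grank_stall_full st; have := grank_leqN z.+2; lia.
(* At [i = s] only a zero increment is possible; the next one is then zero too by concavity, which
   is a stall. *)
have := grank_stall_full (z := y + s); have := decr s.
have := grank_concave (y + s); have := grank_mono (y + s); have := grank_mono (y + s).+1.
lia.
Qed.

(** An increment below [s] at [z] would give [grank (z + s) = N], whereas [z + s] points span at
    most [(z + s) * s], which the bound for [z.+1] makes smaller than [N]. *)
Lemma grank_independent z : ((z + s) * s <= N)%N -> grank z = (z * s)%N.
Proof.
move=> zsN; elim: z zsN => [|z IH] zsN; first by rewrite grank0.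
have [lt|] := ltnP (grank z.+1) (grank z + s).
  have := grank_full lt; have := leq_grank_mul (z + s); have := grank_mono z.
  by move: zsN lt; rewrite addSn mulSn; lia.
rewrite IH; last by apply: leq_trans zsN; rewrite leq_mul2r leq_add2r leqnSn orbT.
by have := leq_grank_mul z.+1; rewrite mulSn; lia.
Qed.

(** If the first [(z - s).+1] increments all equalled [s], their sum would exceed [N]. So one of
    them drops at some [y <= z - s], and rank [N] is reached by [y + s <= z]. *)
Lemma grank_span z : (0 < s)%N -> (N + s * s <= z * s)%N -> grank z = N.
Proof.
move=> s0 Nz.
have [|[y yw /grank_full yN]] : grank (z - s).+1 = ((z - s).+1 * s)%N \/
    exists2 y, (y < (z - s).+1)%N & (grank y.+1 < grank y + s)%N.
- elim: (z - s).+1 => [|w [IH|[y yw lt]]]; first by left; rewrite grank0.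
    have [lt|ge] := ltnP (grank w.+1) (grank w + s); first by right; exists w.
    by left; have := leq_grank_mul w.+1; rewrite mulSn -IH in ge *; lia.
  by right; exists y => //; apply: ltnW.
- have := grank_leqN (z - s).+1; rewrite mulSn mulnBl; lia.
have sz : (s <= z)%N by rewrite -(leq_pmul2r s0); lia.
apply/eqP; rewrite eqn_leq grank_leqN -[X in (X <= _)%N]yN.
have -> : z = (y + s + (z - (y + s)))%N by lia.
exact: leq_grank_add.
Qed.

End GenericRank.

(** * Forms and coordinate changes *)

Lemma digits_inj B n (a b : 'I_n -> nat) :
  (forall i, a i < B)%N -> (forall i, b i < B)%N ->
  (\sum_i a i * B ^ i = \sum_i b i * B ^ i)%N -> a =1 b.
Proof.
elim: n a b => [|n IH] a b aB bB; first by move=> _ [].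
have split (c : 'I_n.+1 -> nat) :
    (\sum_i c i * B ^ i = (\sum_(i < n) c (lift ord0 i) * B ^ i) * B + c ord0)%N.
  rewrite big_ord_recl expn0 muln1 addnC big_distrl /=; congr (_ + _)%N.
  by apply: eq_bigr => i _; rewrite /bump add1n expnSr mulnA.
rewrite !split => e; have B0 : (0 < B)%N by apply: leq_ltn_trans (aB ord0).
have e0 : a ord0 = b ord0.
  by have := congr1 (modn^~ B) e; rewrite !modnMDl !modn_small.
have eS := IH _ _ (fun i => aB (lift ord0 i)) (fun i => bB (lift ord0 i)).
move: e; rewrite e0 => /addIn/eqP; rewrite eqn_pmul2r // => /eqP/eS{}eS i.
by case: (unliftP ord0 i) => [j|] ->.
Qed.

(* Kronecker substitution: ['X_i] is sent to the power [B ^ i] of a single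
   variable, where [B] exceeds all the exponents occurring in [f]. *)
Lemma meval_neq0 (K : closedFieldType) n (f : {mpoly K[n]}) :
  f != 0 -> exists c, f.@[c] != 0.
Proof.
move=> f0; pose B := msize f; pose kappa (M : 'X_{1..n}) := (\sum_i M i * B ^ i)%N.
pose p : {poly K} := \sum_(M <- msupp f) f@_M *: 'X^(kappa M).
have kappa_inj : {in msupp f &, injective kappa}.
  move=> M M' fM fM' /digits_inj e; apply/mnmP; apply: e => i.
    by apply: leq_ltn_trans (msize_mdeg_lt fM); rewrite mdegE (bigD1 i) //= leq_addr.
  by apply: leq_ltn_trans (msize_mdeg_lt fM'); rewrite mdegE (bigD1 i) //= leq_addr.
have : p != 0.
  have fM := mlead_supp f0; apply: contraNneq f0 => p0; rewrite -mleadc_eq0.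
  have := congr1 (fun q : {poly K} => q`_(kappa (mlead f))) p0.
  rewrite coef0 coef_sum (bigD1_seq (mlead f)) ?msupp_uniq //= coefZ coefXn eqxx mulr1.
  rewrite big_seq_cond big1 ?addr0 => [->|M /andP[fM' Mf]] //.
  rewrite coefZ coefXn; case: eqP => [/kappa_inj e|]; rewrite ?mulr0 //.
  by rewrite e ?eqxx in Mf.
move=> /closed_nonrootP[t pt]; exists (fun i => t ^+ (B ^ i)).
apply: contraNneq pt => ft; apply/rootP; rewrite -ft mevalE horner_sum.
apply: eq_bigr => M _; rewrite hornerZ hornerXn; congr (_ * _).
by rewrite -prodrXr; apply: eq_bigr => i _; rewrite -exprM mulnC.
Qed.

(** * Polynomial curves of forms, multiplication matrices and linear substitutions *)

Section Forms.
Variables (n : nat) (K : closedFieldType).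
Local Notation R := {mpoly K[n.+1]}.
Local Notation H m := (dhomog n.+1 K m).

Definition pcurve (c : K -> R) : Prop :=
  exists P : {poly R}, forall t, c t = P.[t%:MP].

Lemma pcurve_const f : pcurve (fun=> f).
Proof. by exists f%:P => t; rewrite hornerC. Qed.

Lemma pcurveD c c' : pcurve c -> pcurve c' -> pcurve (fun t => c t + c' t).
Proof. by move=> [P PE] [P' PE']; exists (P + P') => t; rewrite hornerD PE PE'. Qed.

Lemma pcurveM c c' : pcurve c -> pcurve c' -> pcurve (fun t => c t * c' t).
Proof. by move=> [P PE] [P' PE']; exists (P * P') => t; rewrite hornerM PE PE'. Qed.

Lemma pcurveX c e : pcurve c -> pcurve (fun t => c t ^+ e).
Proof. by move=> [P PE]; exists (P ^+ e) => t; rewrite horner_exp PE. Qed.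

Lemma pcurve_sum I (r : seq I) (c : I -> K -> R) :
  (forall i, pcurve (c i)) -> pcurve (fun t => \sum_(i <- r) c i t).
Proof.
move=> cP; elim: r => [|i r [P PE]].
  by exists 0 => t; rewrite big_nil horner0.
by have [P' PE'] := cP i; exists (P' + P) => t; rewrite big_cons hornerD PE PE'.
Qed.

Lemma pcurve_prod I (r : seq I) (c : I -> K -> R) :
  (forall i, pcurve (c i)) -> pcurve (fun t => \prod_(i <- r) c i t).
Proof.
move=> cP; elim: r => [|i r [P PE]].
  by exists 1 => t; rewrite big_nil hornerC.
by have [P' PE'] := cP i; exists (P' * P) => t; rewrite big_cons hornerM PE PE'.
Qed.

Lemma pcurve_scale (p : {poly K}) f : pcurve (fun t => p.[t] *: f).
Proof.
exists (f *: map_poly (@mpolyC n.+1 K) p) => t.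
by rewrite hornerZ horner_map mulrC mul_mpolyC.
Qed.

Lemma eq_pcurve c c' : c =1 c' -> pcurve c -> pcurve c'.
Proof. by move=> e [P PE]; exists P => t; rewrite -e. Qed.

Lemma horner_linear a b (phi : {linear R -> 'M[K]_(a, b)}) (P : {poly R}) t i j :
  phi P.[t%:MP] i j = (\poly_(e < size P) phi P`_e i j).[t].
Proof.
rewrite horner_poly horner_coef linear_sum summxE; apply: eq_bigr => e _.
by rewrite -rmorphXn [P`_e * _]mulrC mul_mpolyC linearZ !mxE mulrC.
Qed.

Lemma linear_coef0 a b (phi : {linear R -> 'M[K]_(a, b)}) (P : {poly R}) e :
  (forall t, phi P.[t%:MP] = 0) -> phi P`_e = 0.
Proof.
move=> P0; apply/matrixP => i j.
have := poly_eq0_fun (fun t => etrans (esym (horner_linear phi P t i j)) _).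
have Pij t : phi P.[t%:MP] i j = 0 by rewrite P0 mxE.
move=> /(_ Pij)/polyP/(_ e); rewrite coef_poly coef0 mxE.
by case: ltnP => // le _; rewrite nth_default // linear0 mxE.
Qed.

Lemma pcurve_linear a b (phi : {linear R -> 'M[K]_(a, b)}) c : pcurve c ->
  exists M : 'M[{poly K}]_(a, b), forall t, map_mx (horner^~ t) M = phi (c t).
Proof.
move=> [P PE]; exists (\matrix_(i, j) \poly_(e < size P) phi P`_e i j) => t.
by apply/matrixP => i j; rewrite !mxE PE horner_linear.
Qed.

Definition hpart m (f : R) : H m := DHomog (pihomogP mdeg m f).

Fact hpart_is_linear m : linear (hpart m).
Proof. by move=> a f g; apply: val_inj; rewrite /= linearP. Qed.

HB.instance Definition _ m :=
  GRing.isLinear.Build K R (H m) _ (hpart m) (hpart_is_linear m).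

Lemma hpartK m (f : H m) : hpart m f = f.
Proof. by apply: val_inj; rewrite /= pihomog_dE //; apply: dhomog_is_dhomog. Qed.

Definition vec m (f : R) : 'rV[K]_(dim (H m)) := v2r (hpart m f).

Fact vec_is_linear m : linear (vec m).
Proof. by move=> a f g; rewrite /vec !linearP. Qed.

HB.instance Definition _ m := GRing.isLinear.Build K R _ _ (vec m) (vec_is_linear m).

Lemma vecE m (f : H m) : vec m f = v2r f.
Proof. by rewrite /vec hpartK. Qed.

Definition mulrow m m' (g : R) (x : 'rV[K]_(dim (H m))) :=
  vec m' (g * mpoly_of_dhomog (r2v x : H m)).

Fact mulrow_is_linear m m' g : linear (@mulrow m m' g).
Proof. by move=> a x y; rewrite /mulrow linearP mulrDr -scalerAr linearP. Qed.

HB.instance Definition _ m m' g :=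
  GRing.isLinear.Build K _ _ _ (@mulrow m m' g) (@mulrow_is_linear m m' g).

(** Projecting the product to degree [m'] defines the matrix for every polynomial [g], linearly in
    [g], so curves of polynomials give curves of matrices. *)
Definition mulM m m' g := lin1_mx (@mulrow m m' g).

Lemma mul_vec_mulM m m' g (f : H m) : vec m f *m mulM m m' g = vec m' (g * (f : R)).
Proof. by rewrite mul_rV_lin1 /= /mulrow vecE v2rK. Qed.

Lemma mul_rV_mulM m m' g (x : 'rV_(dim (H m))) :
  x *m mulM m m' g = vec m' (g * mpoly_of_dhomog (r2v x : H m)).
Proof. by rewrite mul_rV_lin1. Qed.

Fact mulM_is_linear m m' : linear (mulM m m').
Proof.
move=> a f g; apply/row_matrixP => i; rewrite !rowE mulmxDr -scalemxAr !mul_rV_mulM.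
by rewrite mulrDl -scalerAl linearP.
Qed.

HB.instance Definition _ m m' :=
  GRing.isLinear.Build K R _ _ (mulM m m') (mulM_is_linear m m').

Lemma hpart_mul_hpart d k F g : F \is d.-homog ->
  hpart (d + k) (F * g) = hpart (d + k) (F * mpoly_of_dhomog (hpart k g)).
Proof.
move=> Fd; apply: val_inj => /=; rewrite [g]mpolyE mulr_sumr.
rewrite !raddf_sum mulr_sumr raddf_sum.
apply: eq_bigr => M _; rewrite -scalerAr /= !linearZ -scalerAr linearZ /=; congr (_ *: _).
rewrite pihomogX; case: eqP => // /eqP Mk.
rewrite mulr0 raddf0 (@pihomog_ne0 _ _ _ (d + mdeg M)) ?eqn_add2l //.
by apply: dhomogM => //; rewrite dhomogX.
Qed.

(** The row space is the degree [d + k] part of the ideal: arbitrary coefficients [g i] may be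
    replaced by their degree [k] parts. *)
Lemma sub_stack_mulM (I : eqType) d k (F : I -> R) J (q : H (d + k)) : uniq J ->
  (forall i, F i \is d.-homog) ->
  reflect (exists g : I -> R, mpoly_of_dhomog q = \sum_(i <- J) g i * F i)
          (vec (d + k) q <= stack (fun i => mulM k (d + k) (F i)) J)%MS.
Proof.
move=> uJ Fd; apply: (iffP (sub_stackP _ _ uJ)) => -[c cE].
  exists (fun i => mpoly_of_dhomog (r2v (c i) : H k)).
  have : vec (d + k) q =
      vec (d + k) (\sum_(i <- J) F i * mpoly_of_dhomog (r2v (c i) : H k)).
    by rewrite cE linear_sum; apply: eq_bigr => i _; apply: mul_rV_mulM.
  move/v2r_inj/(congr1 val); rewrite /= pihomog_dE ?dhomog_is_dhomog // => ->.
  rewrite pihomog_dE; first by apply: eq_bigr => i _; rewrite mulrC.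
  by apply: rpred_sum => i _; apply: dhomogM => //; apply: dhomog_is_dhomog.
exists (fun i => vec k (c i)); rewrite cE linear_sum; apply: eq_bigr => i _.
by rewrite -[vec k _](vecE (hpart k (c i))) mul_vec_mulM mulrC /vec -hpart_mul_hpart.
Qed.

Definition lform (u : 'rV[K]_n.+1) : R := \sum_j u 0 j *: 'X_j.

Lemma lform_homog u : lform u \is 1.-homog.
Proof. by apply: rpred_sum => j _; apply: rpredZ; rewrite dhomogX /= mdeg1. Qed.

Lemma lform_homogX u m : lform u ^+ m \is m.-homog.
Proof. by have := dhomogMn m (lform_homog u); rewrite mul1n. Qed.

Fact lform_is_linear : linear lform.
Proof.
move=> a u v; rewrite /lform scaler_sumr -big_split; apply: eq_bigr => j _.
by rewrite !mxE scalerDl scalerA.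
Qed.

HB.instance Definition _ := GRing.isLinear.Build K _ R _ lform lform_is_linear.

Lemma lform_delta j : lform (delta_mx 0 j) = 'X_j.
Proof.
rewrite /lform (bigD1 j) //= big1 ?addr0 => [|l /negPf lj]; rewrite !mxE eqxx.
  by rewrite eqxx scale1r.
by rewrite lj scale0r.
Qed.

HB.instance Definition _ (A : 'M[K]_n.+1) :=
  GRing.RMorphism.copy (lin_change A)
    (comp_mpoly [tuple \sum_(j < n.+1) A i j *: 'X_j | i < n.+1]).
HB.instance Definition _ (A : 'M[K]_n.+1) :=
  GRing.Linear.copy (lin_change A)
    (comp_mpoly [tuple \sum_(j < n.+1) A i j *: 'X_j | i < n.+1]).

Lemma lin_changeX (A : 'M[K]_n.+1) i : lin_change A 'X_i = lform (row i A).
Proof.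
rewrite /lin_change comp_mpolyXU -tnth_nth tnth_mktuple.
by apply: eq_bigr => j _; rewrite mxE.
Qed.

Lemma lin_changeE (A : 'M[K]_n.+1) f : lin_change A f =
  \sum_(M <- msupp f) f@_M *: \prod_i lform (row i A) ^+ M i.
Proof.
rewrite {1}[f]mpolyE linear_sum; apply: eq_bigr => M _; rewrite linearZ /=.
congr (_ *: _); rewrite mpolyXE_id rmorph_prod; apply: eq_bigr => i _.
by rewrite rmorphXn /= lin_changeX.
Qed.

Lemma lin_change_lform A u : lin_change A (lform u) = lform (u *m A).
Proof.
rewrite mulmx_sum_row [RHS]linear_sum [LHS]linear_sum.
by apply: eq_bigr => i _; rewrite !linearZ /= lin_changeX.
Qed.

Lemma lin_change_comp (A B : 'M[K]_n.+1) f :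
  lin_change A (lin_change B f) = lin_change (B *m A) f.
Proof.
rewrite (lin_changeE B) (lin_changeE (B *m A)) linear_sum; apply: eq_bigr => M _.
rewrite linearZ rmorph_prod; congr (_ *: _); apply: eq_bigr => i _.
by rewrite rmorphXn /= lin_change_lform row_mul.
Qed.

Lemma lin_change1 (f : R) : lin_change 1%:M f = f.
Proof.
rewrite lin_changeE [RHS]mpolyE; apply: eq_bigr => M _; congr (_ *: _).
rewrite mpolyXE_id; apply: eq_bigr => i _; congr (_ ^+ _).
by rewrite row1 lform_delta.
Qed.

Lemma lin_change_homog (A : 'M[K]_n.+1) m f :
  f \is m.-homog -> lin_change A f \is m.-homog.
Proof.
move=> fm; rewrite lin_changeE big_seq; apply: rpred_sum => M fM; apply: rpredZ.
rewrite -(dhomog_mf fm fM) /= mdegE; elim/big_rec2: _ => [|i p e _ pe].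
  exact: dhomog1.
apply: dhomogM => //; exact: lform_homogX.
Qed.

(** Each variable becomes a multiple [c i] of one linear form, and homogeneity factors out its
    power. This is the degeneration of a form to a power. *)
Lemma lin_change_rank1 (c : 'I_n.+1 -> K) (u : 'rV_n.+1) m f : f \is m.-homog ->
  lin_change (\matrix_(i, j) (c i * u 0 j)) f = f.@[c] *: lform u ^+ m.
Proof.
move=> fm; rewrite lin_changeE mevalE scaler_suml big_seq [RHS]big_seq.
apply: eq_bigr => M fM; rewrite -scalerA; congr (_ *: _).
rewrite -(dhomog_mf fm fM) /= mdegE; elim/big_rec3: _ => [|i x e p _ ->].
  by rewrite scale1r expr0.
have -> : lform (row i (\matrix_(i0, j) (c i0 * u 0 j))) = c i *: lform u.
  by rewrite -linearZ; congr lform; apply/rowP => j; rewrite !mxE.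
by rewrite exprZn exprD -scalerAl -scalerAr scalerA.
Qed.

Lemma pcurve_lin_change (A : 'M[{poly K}]_n.+1) f :
  pcurve (fun t => lin_change (map_mx (horner^~ t) A) f).
Proof.
apply: eq_pcurve; first by move=> t; rewrite lin_changeE.
apply: pcurve_sum => M.
have sc c : pcurve c -> pcurve (fun t => f@_M *: c t).
  move=> cP; apply: eq_pcurve _ (pcurveM (pcurve_const (f@_M)%:MP) cP) => t.
  by rewrite mul_mpolyC.
apply: sc; apply: pcurve_prod => i; apply: pcurveX; apply: pcurve_sum => j.
by apply: eq_pcurve _ (pcurve_scale (A i j) 'X_j) => t; rewrite !mxE.
Qed.


Definition segment (A B : 'M[K]_n.+1) : 'M[{poly K}]_n.+1 :=
  (1 - 'X) *: map_mx polyC A + 'X *: map_mx polyC B.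

Lemma segmentE A B t : map_mx (horner^~ t) (segment A B) = (1 - t) *: A + t *: B.
Proof. by apply/matrixP => i j; rewrite !mxE !hornerE. Qed.

Lemma horner_det (A : 'M[{poly K}]_n.+1) t : (\det A).[t] = \det (map_mx (horner^~ t) A).
Proof.
by rewrite -horner_evalE -det_map_mx; congr (\det _); apply/matrixP=> i j; rewrite !mxE.
Qed.

(** Polarization: the linear factors of a power are traded one by one for variables, until only
    monomials remain. *)
Lemma powers_span m a (V : 'M[K]_(a, dim (H m))) : [pchar K] =i pred0 ->
  (forall u, (vec m (lform u ^+ m) <= V)%MS) -> forall f, (vec m f <= V)%MS.
Proof.
move=> char0 Vu f; pose phi : {linear R -> _} := mulmxr (cokermx V) \o vec m.
have phiE g : (vec m g <= V)%MS = (phi g == 0) by rewrite submxE.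
have phi0 i M u : (i <= m)%N -> mdeg M = i -> phi (lform u ^+ (m - i) * 'X_[M]) = 0.
  elim: i M u => [|i IH] M u im.
    move/eqP; rewrite mdeg_eq0 => /eqP->.
    by rewrite mpolyX0 mulr1 subn0; apply/eqP; rewrite -phiE.
  move=> Mi; have [j Mj] : exists j, M j != 0%N.
    apply/existsP; rewrite -negb_forall; apply: contra_eqN Mi => /forallP M0.
    by rewrite mdegE big1 // => j _; apply/eqP.
  have jM : (U_(j) <= M)%MM by rewrite lep1mP.
  pose M' := (M - U_(j))%MM.
  have M'i : mdeg M' = i.
    apply/eqP; rewrite -(eqn_add2r 1) -(mdeg1 j) -mdegD submK //.
    by rewrite Mi mdeg1 addn1.
  pose e := (m - i.+1)%N; have me : (m - i = e.+1)%N by rewrite /e; lia.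
  (* The induction hypothesis puts all values of [P] in [V], hence also its coefficient of degree 1,
     which is [e.+1] times the wanted product; [e.+1] is invertible in characteristic zero. *)
  pose P : {poly R} := ((lform u)%:P + 'X_j *: 'X) ^+ e.+1 * ('X_[M'])%:P.
  have P0 t : phi P.[t%:MP] = 0.
    rewrite -(IH M' (t *: delta_mx 0 j + u) (ltnW im) M'i) me; congr (phi _).
    by rewrite !hornerE linearP /= lform_delta addrC -mul_mpolyC [_%:MP * _]mulrC.
  have := linear_coef0 1 P0.
  have -> : P`_1 = (lform u ^+ e * 'X_[M]) *+ e.+1.
    have := coef_deriv P 0; rewrite mulr1n => <-; rewrite -horner_coef0 /P.
    rewrite derivM derivC mulr0 addr0 deriv_exp !derivD derivC add0r derivZ derivX.
    rewrite hornerM hornerC hornerMn hornerM hornerZ hornerC mulr1 horner_exp.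
    rewrite hornerD hornerZ hornerX mulr0 addr0 hornerC -(submK jM) mpolyXD.
    by rewrite mulrnAl [_ * lform u ^+ _]mulrC -mulrA ['X_j * _]mulrC.
  rewrite linearMn -scaler_nat => /eqP; rewrite scaler_eq0.
  by rewrite ((pcharf0P _).1 char0) => /eqP.
rewrite phiE [f]mpolyE linear_sum big1 // => M _; rewrite linearZ.
suff -> : phi 'X_[M] = 0 by apply: scaler0.
have [Mm|Mm] := eqVneq (mdeg M) m.
  by have := phi0 m M 0 (leqnn m) Mm; rewrite subnn mul1r.
have X0 : hpart m 'X_[M] = 0 by apply: val_inj; rewrite /= pihomogX (negPf Mm).
by rewrite /phi /= /vec X0 linear0 mul0mx.
Qed.

Lemma orbit_span m a (V : 'M[K]_(a, dim (H m))) (q : H m) : [pchar K] =i pred0 ->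
  q != 0 -> (forall A, A \in unitmx -> (vec m (lin_change A q) <= V)%MS) ->
  forall f, (vec m f <= V)%MS.
Proof.
move=> char0 q0 Vq; apply: powers_span => // u.
pose phi : {linear R -> _} := mulmxr (cokermx V) \o vec m.
have phiE g : (vec m g <= V)%MS = (phi g == 0) by rewrite submxE.
(* Singular matrices are limits of invertible ones: on the segment from the identity to [A], almost
   all matrices are invertible. Rank one matrices then yield all powers. *)
have Vall A : phi (lin_change A q) = 0.
  have [M MP] := pcurve_linear phi (pcurve_lin_change (segment 1%:M A) q).
  have := MP 1; rewrite segmentE subrr scale0r add0r scale1r => <-.
  apply/matrixP => i j; rewrite !mxE; have -> : M i j = 0; last by rewrite horner0.
  apply: horner_eq0_cofinite.
  have : (\det (segment 1%:M A)).[0] != 0.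
    by rewrite horner_det segmentE subr0 scale1r scale0r addr0 det1 oner_neq0.
  move/cofinite_poly; apply: cofiniteS => t; rewrite horner_det -unitfE => /Vq.
  by rewrite phiE -MP => /eqP/matrixP/(_ i j); rewrite !mxE.
have [c qc] := meval_neq0 (q0 : mpoly_of_dhomog q != 0).
have := Vall (\matrix_(i, j) (c i * u 0 j)).
rewrite (lin_change_rank1 _ _ (dhomog_is_dhomog q)) linearZ phiE => /eqP.
by rewrite scaler_eq0 (negPf qc).
Qed.

Lemma lin_change_vec m A (q : H m) :
  vec m (lin_change A q) = vec m (hpart m (lin_change A q)).
Proof. by rewrite vecE. Qed.

Lemma hpart_lin_change m A (q : H m) :
  mpoly_of_dhomog (hpart m (lin_change A q)) = lin_change A q.
Proof. by rewrite /= pihomog_dE // lin_change_homog // dhomog_is_dhomog. Qed.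

Definition act_row m (A : 'M[K]_n.+1) (x : 'rV[K]_(dim (H m))) :=
  vec m (lin_change A (r2v x : H m)).

Fact act_row_is_linear m A : linear (@act_row m A).
Proof. by move=> a x y; rewrite /act_row !linearP. Qed.

HB.instance Definition _ m A :=
  GRing.isLinear.Build K _ _ _ (@act_row m A) (@act_row_is_linear m A).

Definition act_mx m A := lin1_mx (@act_row m A).

Lemma mul_act_mx m A (q : H m) : vec m q *m act_mx m A = vec m (lin_change A q).
Proof. by rewrite mul_rV_lin1 /= /act_row vecE v2rK. Qed.

Lemma act_mx_free m A : A \in unitmx -> row_free (act_mx m A).
Proof.
move=> uA; apply/row_freeP; exists (act_mx m (invmx A)).
apply/row_matrixP => i; rewrite row_mul row1 rowE.
rewrite -[delta_mx 0 i]r2vK -[v2r _]vecE mul_act_mx lin_change_vec mul_act_mx.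
by rewrite hpart_lin_change lin_change_comp mulmxV // lin_change1.
Qed.

(** * Ideals generated by powers of linear forms *)

Section Powers.
Variables d k : nat.
Local Notation s := (dim (H k)).
Local Notation N := (dim (H (d + k))).

Definition powM u : 'M[K]_(s, N) := mulM k (d + k) (lform u ^+ d).
Local Notation W L J := (stack (powM \o L) J).

Lemma powM_line u v : exists M : 'M[{poly K}]_(s, N),
  forall t, map_mx (horner^~ t) M = powM ((1 - t) *: u + t *: v).
Proof.
apply: pcurve_linear; apply: pcurveX.
apply: eq_pcurve _ (pcurveD (pcurve_scale (1 - 'X) (lform u))
                            (pcurve_scale 'X (lform v))) => t.
by rewrite !hornerE linearD !linearZ.
Qed.

Lemma mulM_free (f : R) : f \is d.-homog -> f != 0 -> row_free (mulM k (d + k) f).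
Proof.
move=> fd f0; rewrite -kermx_eq0; apply/rowV0P => x /sub_kermxP.
rewrite mul_rV_mulM -(linear0 (vec _)) => /v2r_inj/(congr1 val)/=.
rewrite linear0 pihomog_dE; last by apply: dhomogM => //; apply: dhomog_is_dhomog.
move/eqP; rewrite mulf_eq0 (negPf f0) /= => /eqP x0.
by rewrite -[x]r2vK -(linear0 v2r); congr v2r; apply: val_inj.
Qed.

Lemma powM_free : exists u, row_free (powM u).
Proof.
exists (delta_mx 0 0); apply: mulM_free; first exact: lform_homogX.
by rewrite expf_neq0 // lform_delta -msupp_eq0 msuppX.
Qed.

Lemma lin_change_stack (L : nat -> 'rV_n.+1) J A (q : H (d + k)) : uniq J ->
  (vec (d + k) q <= W L J)%MS ->
  (vec (d + k) (lin_change A q) <= W (fun i => L i *m A) J)%MS.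
Proof.
move=> uJ /(sub_stack_mulM _ uJ (fun i => lform_homogX (L i) d))[g qE].
rewrite lin_change_vec; apply/sub_stack_mulM => //; first by move=> i; apply: lform_homogX.
exists (fun i => lin_change A (g i)); rewrite hpart_lin_change qE linear_sum.
by apply: eq_bigr => i _; rewrite rmorphM rmorphXn /= lin_change_lform.
Qed.

Lemma mxrank_lin_change (L : nat -> 'rV_n.+1) J A : uniq J -> A \in unitmx ->
  (\rank (W L J) <= \rank (W (fun i => L i *m A) J))%N.
Proof.
move=> uJ uA; rewrite -(mxrankMfree _ (act_mx_free (d + k) uA)); apply: mxrankS.
apply/row_subP => i; rewrite row_mul -[row i _]r2vK -[v2r _]vecE mul_act_mx.
by apply: lin_change_stack => //; rewrite vecE r2vK row_sub.
Qed.

Hypothesis char0 : [pchar K] =i pred0.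

(** Coordinate changes preserve the rank, so [q] also lies in the space of the points
    [L i *m invmx A]; applying [A] puts the whole orbit of [q] in [W L], and [orbit_span]
    concludes. *)
Lemma powM_irr z (q : 'rV[K]_N) : q != 0 ->
  (forall L, \rank (W L (iota 0 z)) = grank powM z -> (q <= W L (iota 0 z))%MS) ->
  grank powM z = N.
Proof.
move=> q0 qW; have [L] := grank_attained powM (iota_uniq 0 z); rewrite size_iota => rL.
rewrite -rL; apply/eqP; rewrite -[_ == _]/(row_full _) -sub1mx.
apply/row_subP => i; rewrite -[row i _]r2vK -[v2r _]vecE.
apply: (orbit_span char0 (q := r2v q)) => [|A uA].
  by rewrite -(inj_eq (@v2r_inj _ _)) r2vK linear0.
have eL : (fun i => L i *m invmx A *m A) = L.
  by apply: functional_extensionality => j; rewrite mulmxKV.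
rewrite -eL; apply: lin_change_stack; first exact: iota_uniq.
rewrite vecE r2vK; apply: qW; apply/eqP; rewrite eqn_leq -{2}rL mxrank_lin_change.
- by have := leq_grank powM (fun j => L j *m invmx A) (iota 0 z); rewrite size_iota => ->.
- exact: iota_uniq.
- by rewrite unitmx_inv.
Qed.

Lemma powers_independent z : ((z + s) * s <= N)%N ->
  exists L, \rank (W L (iota 0 z)) = (z * s)%N.
Proof.
move=> /(grank_independent powM_line powM_free powM_irr) rz.
by have [L] := grank_attained powM (iota_uniq 0 z); rewrite size_iota rz; exists L.
Qed.

Lemma powers_spanning z : (0 < s)%N -> (N + s * s <= z * s)%N ->
  exists L, \rank (W L (iota 0 z)) = N.
Proof.
move=> s0 /(grank_span powM_line powM_free powM_irr s0) rz.
by have [L] := grank_attained powM (iota_uniq 0 z); rewrite size_iota rz; exists L.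
Qed.

End Powers.

End Forms.

(** * Genericity in a class of forms *)

Lemma cofinite_all (K : closedFieldType) (I : finType) (Q : I -> K -> Prop) :
  (forall i, cofinite (Q i)) -> cofinite (fun t => forall i, Q i t).
Proof.
move=> cQ; have /fin_all_exists[p pP] i : exists p : {poly K},
    p != 0 /\ forall t, p.[t] != 0 -> Q i t by have [p] := cQ i; exists p.
exists (\prod_i p i); first by apply/prodf_neq0 => i _; have [] := pP i.
by move=> t; rewrite horner_prod => /prodf_neq0 pt i; apply: (pP i).2; apply: pt.
Qed.

(** * Zariski open sets along polynomial curves *)

Section ZariskiCurves.
Variables (K : closedFieldType) (V : vectType K).

Definition vcurve (c : K -> V) : Prop :=
  exists m (G : nat -> V), forall t, c t = \sum_(e < m) t ^+ e *: G e.

Lemma zariski_open_curve (U : V -> Prop) c t0 : zariski_open U -> vcurve c ->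
  U (c t0) -> cofinite (fun t => U (c t)).
Proof.
move=> [E UE] [m [G cE]] /UE[P EP Pt0].
pose q j : {poly K} := \poly_(e < m) coord (vbasis {: V}) j (G e).
pose p : {poly K} := \sum_(M <- msupp P) P@_M *: \prod_j q j ^+ M j.
have pE t : p.[t] = polyfun P (c t).
  rewrite /polyfun mevalE horner_sum; apply: eq_bigr => M _; rewrite hornerZ horner_prod.
  congr (_ * _); apply: eq_bigr => j _; rewrite horner_exp horner_poly; congr (_ ^+ _).
  by rewrite cE linear_sum; apply: eq_bigr => e _; rewrite linearZ /= mulrC.
rewrite -pE in Pt0; have := cofinite_poly Pt0; apply: cofiniteS => t.
by rewrite pE => Pt; apply/UE; exists P.
Qed.

Lemma zariski_open_mxrank a b (Phi : {linear V -> 'M[K]_(a, b)}) h :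
  zariski_open (fun v => h <= \rank (Phi v))%N.
Proof.
(* Taking every polynomial whose nonvanishing forces the rank bound, it remains to find one that is
   nonzero at [v]: the determinant of a compression. *)
exists (fun P => forall v, polyfun P v != 0 -> (h <= \rank (Phi v))%N) => v.
split=> [hv|[P + Pv]]; last exact.
have [B [C BC]] := mxrank_witness (Phi v).
pose M : 'M[{mpoly K[\dim {: V}]}]_(\rank (Phi v)) := \matrix_(i, j)
  \sum_(l < \dim {: V}) (B *m Phi (vbasis {: V})`_l *m C) i j *: 'X_l.
have ME w : polyfun (\det M) w = \det (B *m Phi w *m C).
  rewrite /polyfun -det_map_mx; congr (\det _); apply/matrixP => i j.
  rewrite {2}(coord_vbasis (memvf w)) linear_sum mulmx_sumr mulmx_suml !mxE raddf_sum summxE.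
  apply: eq_bigr => l _; rewrite /= mevalZ mevalXU linearZ -scalemxAr -scalemxAl.
  by rewrite [RHS]mxE mulrC.
exists (\det M); last by rewrite ME BC det1 oner_neq0.
by move=> w; rewrite ME => /mxrank_ge; apply: leq_trans.
Qed.

End ZariskiCurves.

(** * Density of the maximal rank locus in the class [D] *)

Section GenericForms.
Variables (n : nat) (K : closedFieldType) (d k z : nat).
Local Notation R := {mpoly K[n.+1]}.
Local Notation H m := (dhomog n.+1 K m).
Local Notation tuples := {ffun 'I_z -> H d}.

Definition ideal_mx (F : tuples) :=
  stack (fun i => mulM k (d + k) (mpoly_of_dhomog (F i))) (enum 'I_z).

Fact ideal_mx_is_linear : linear ideal_mx.
Proof.
move=> a F G; rewrite /ideal_mx -stackZ -stackD; apply: eq_stack => i _.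
rewrite !ffunE. exact: linearP.
Qed.

HB.instance Definition _ := GRing.isLinear.Build K tuples _ _ ideal_mx ideal_mx_is_linear.

Lemma graded_dim_ideal_mx (F : tuples) :
  graded_dim (in_ideal F) (d + k) (\rank (ideal_mx F)).
Proof.
exists (mx2vs (ideal_mx F)); last by rewrite /dimv mx2vsK.
move=> p; rewrite memvE /subsetv !genmxE -vecE.
have iP := sub_stack_mulM (k := k) p (enum_uniq 'I_z) (fun i => dhomog_is_dhomog (F i)).
by split=> [/iP[g pE]|[g pE]]; [|apply/iP]; exists g; rewrite pE big_enum.
Qed.

Lemma vcurve_forms (c : 'I_z -> K -> R) : (forall i, pcurve (c i)) ->
  vcurve (fun t => [ffun i => hpart d (c i t)] : tuples).
Proof.
move=> /fin_all_exists[P PE].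
exists (\max_i size (P i)), (fun e => [ffun i => hpart d (P i)`_e]) => t.
apply/ffunP => i; rewrite sum_ffunE !ffunE PE.
rewrite (horner_coef_wide _ (leq_bigmax (F := fun i => size (P i)) i)) linear_sum.
apply: eq_bigr => e _.
by rewrite !ffunE -rmorphXn mulrC mul_mpolyC linearZ.
Qed.

Lemma lin_change0 (f : H d) : (0 < d)%N -> lin_change (0 : 'M[K]_n.+1) f = 0.
Proof.
move=> d0; have -> : (0 : 'M[K]_n.+1) = \matrix_(i, j) (0 * (0 : 'rV_n.+1) 0 j).
  by apply/matrixP => i j; rewrite !mxE mul0r.
rewrite (lin_change_rank1 (fun=> 0) 0 (dhomog_is_dhomog f)) linear0.
by rewrite expr0n eqn0Ngt d0 scaler0.
Qed.

Variable D : H d -> Prop.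
Hypotheses (d0 : (0 < d)%N) (D_closed : closed_lin_change D).
Hypothesis D_neq0 : exists2 f, D f & f != 0.

(* Every [F i] degenerates to a multiple of the [d]-th power of the linear form
   [L i], along a line of coordinate changes; if [F i = 0] the line starts at
   the zero matrix instead of the identity. *)
Lemma dense_in_mxrank (L : nat -> 'rV[K]_n.+1) h :
  (h <= \rank (stack (powM d k \o L) (iota 0 z)))%N ->
  dense_in (fun F : tuples => forall i, D (F i)) (fun F => h <= \rank (ideal_mx F))%N.
Proof.
move=> hL W oW [F0 DF0 WF0]; have [f0 Df0 f0_neq0] := D_neq0.
pose f i := if F0 i == 0 then f0 else F0 i.
have Df i : D (f i) by rewrite /f; case: eqP.
have f_neq0 i : f i != 0 by rewrite /f; case: (eqVneq (F0 i)).
have /fin_all_exists[c fc] i : exists c, (mpoly_of_dhomog (f i)).@[c] != 0.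
  exact: (meval_neq0 (f_neq0 i : mpoly_of_dhomog (f i) != 0)).
pose B i := segment 1%:M (\matrix_(a, b) (c i a * L i 0 b)).
(* At [t = 0] the tuple is [F0], in the open set [W]; at [t = 1] it consists of nonzero multiples of
   the powers of [L i], because [c i] is not a zero of [f i]. *)
pose A i := if F0 i == 0 then 'X *: B i else B i.
pose g i t := lin_change (map_mx (horner^~ t) (A i)) (f i).
pose F t : tuples := [ffun i => hpart d (g i t)].
have FE t i : mpoly_of_dhomog (F t i) = g i t by rewrite ffunE hpart_lin_change.
have vF : vcurve F by apply: vcurve_forms => i; apply: pcurve_lin_change.
have F_0 : F 0 = F0.
  apply/ffunP => i; apply: val_inj; rewrite /= FE /g /A /f; case: eqP => [->|_].
    have -> : map_mx (horner^~ 0) ('X *: B i) = 0.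
      by apply/matrixP => a b; rewrite !mxE hornerM hornerX mul0r.
    by rewrite lin_change0.
  by rewrite segmentE subr0 scale1r scale0r addr0 lin_change1.
have F_1 i : mpoly_of_dhomog (F 1 i) = (mpoly_of_dhomog (f i)).@[c i] *: lform (L i) ^+ d.
  rewrite FE /g -lin_change_rank1 ?dhomog_is_dhomog //; congr (lin_change _ _).
  have <- : map_mx (horner^~ 1) (B i) = \matrix_(a, b) (c i a * L i 0 b).
    by rewrite segmentE subrr scale0r add0r scale1r.
  rewrite /A; case: eqP => // _; apply/matrixP => a b.
  by rewrite 2!mxE hornerM hornerX mul1r [RHS]mxE.
have U1 : (h <= \rank (ideal_mx (F 1%R)))%N.
  apply: leq_trans hL _; apply/mxrankS/stack_subP => i; rewrite mem_iota => /= iz.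
  pose i' := Ordinal iz.
  have := sub_stack (fun i => mulM k (d + k) (mpoly_of_dhomog (F 1 i)))
    (mem_enum _ i' : i' \in enum 'I_z).
  by rewrite F_1 linearZ; apply: submx_trans; rewrite eqmx_scale // fc.
(* Closure of [D] needs invertible matrices: the determinant of [B i] is nonzero at 0, and the
   factor ['X] only excludes [t = 0]. *)
have cA : cofinite (fun t => forall i, D (F t i)).
  apply: cofinite_all => i.
  have : (\det (B i)).[0] != 0.
    by rewrite horner_det segmentE subr0 scale1r scale0r addr0 det1 oner_neq0.
  move/cofinite_poly => cB; have := @cofinite_poly K 'X 1.
  rewrite hornerX oner_neq0 => /(_ isT) cX.
  have := cofiniteI cB cX; apply: cofiniteS => t [].
  rewrite horner_det hornerX -unitfE => uB t0.
  apply: (@D_closed (map_mx (horner^~ t) (A i)) (f i)) => //.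
  rewrite /A; case: eqP => // _.
  have -> : map_mx (horner^~ t) ('X *: B i) = t *: map_mx (horner^~ t) (B i).
    by apply/matrixP => a b; rewrite !mxE hornerM hornerX.
  by rewrite unitmxZ ?unitfE.
have cU : cofinite (fun t => h <= \rank (ideal_mx (F t)))%N.
  exact: zariski_open_curve (zariski_open_mxrank ideal_mx h) vF U1.
have cW : cofinite (fun t => W (F t)).
  by apply: (zariski_open_curve (t0 := 0)); rewrite ?F_0.
by have [t [DF [UF WF]]] := cofinite_ex (cofiniteI cA (cofiniteI cU cW)); exists (F t).
Qed.

(** As [h] bounds the rank for every tuple, the open dense condition of rank at least [h] fixes the
    dimension exactly. *)
Lemma HF_mxrank (L : nat -> 'rV[K]_n.+1) h :
  \rank (stack (powM d k \o L) (iota 0 z)) = h ->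
  (forall F, \rank (ideal_mx F) <= h)%N -> HF D z (d + k) h.
Proof.
move=> rL hmax; exists (fun F => h <= \rank (ideal_mx F))%N; split.
- exact: zariski_open_mxrank.
- by apply: (dense_in_mxrank (L := L)); rewrite rL.
move=> F _ hF; have -> : h = \rank (ideal_mx F) by apply/eqP; rewrite eqn_leq hF hmax.
exact: graded_dim_ideal_mx.
Qed.

End GenericForms.

(** * The Hilbert function in degree [d + k] for both ranges of [z] *)

Theorem theorem1 (K : closedFieldType) (n : nat) (d k : nat)
    (D : dhomog n.+1 K d -> Prop) :
  [pchar K] =i pred0 ->
  (0 < d)%N -> (0 < k)%N ->
  (exists2 f, D f & f != 0) ->
  closed_lin_change D ->
  (forall z : nat,
     (z%:R <= (dimS n K (d + k))%:R / (dimS n K k)%:R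
              - (dimS n K k)%:R :> rat) ->
     HF D z (d + k) (z * dimS n K k)%N)
  /\
  (forall z : nat,
     (z%:R >= (dimS n K (d + k))%:R / (dimS n K k)%:R
              + (dimS n K k)%:R :> rat) ->
     HF D z (d + k) (dimS n K (d + k))).
Proof.
move=> char0 d0 k0 D_neq0 D_closed; rewrite /dimS !dimvf.
set s := dim (dhomog n.+1 K k); set N := dim (dhomog n.+1 K (d + k)).
have s0 : (0 < s)%N by rewrite bin_gt0 leq_addr.
have s0Q : (0 < s%:R :> rat) by rewrite ltr0n.
split=> z zP.
  have [|L rL] := @powers_independent n K d k char0 z.
    (* Clearing the denominator [s] turns the rational bound into [(z + s) * s <= N]. *)
    rewrite -/s -/N -(ler_nat rat) natrM natrD -ler_pdivlMr //.
    by rewrite -lerBrDr.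
  apply: (HF_mxrank d0 D_closed D_neq0 rL) => F.
  by apply: leq_trans (rank_leq_row _) _; rewrite stack_rowsE size_enum_ord.
have [|L rL] := @powers_spanning n K d k char0 z s0.
  rewrite -/s -/N -(ler_nat rat) natrD !natrM -lerBrDr -mulrBl -ler_pdivrMr //.
  by rewrite lerBrDr.
by apply: (HF_mxrank d0 D_closed D_neq0 rL) => F; apply: rank_leq_col.
Qed.
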